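(* Let $n,N,l$ be positive integers, let $A_1,\ldots,A_N,B_1,\ldots,B_N\in\mathbb{R}^{n\times n}$ be (entrywise) nonnegative matrices, and let $f:\mathbb{R}^n\to\mathbb{R}^n$ be an admissible diagonal nonlinearity. If there exist real numbers $\mu>0$, $\lambda>0$ and vectors $d\gg 0$, $\theta\gg 0$ in $\mathbb{R}^n$ such that $$(A_s+B_r)^Td\le\mu d,\qquad s,r=1,\ldots,N,$$ $$(A_s+B_s)\theta\le\lambda\theta,\qquad s=1,\ldots,N,$$ $$\lambda\mu<1,$$ then there exists a common Lyapunov--Krasovskii functional of the form $$V(x^{(k)})=x^T(k)Px(k)+x^T(k-1)Q_1x(k-1)+\ldots+x^T(k-l)Q_lx(k-l),$$ with $P,Q_1,\ldots,Q_l$ positive definite diagonal matrices, for the family of subsystems $$x(k+1)=f\left(A_sx(k)+B_sx(k-l)\right),\qquad s=1,\ldots,N.$$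
   Context: Vector inequalities are componentwise: $v\le w$ means $v_i\le w_i$ for all $i$, and $v\gg 0$ means $v_i>0$ for all $i$. An admissible diagonal nonlinearity is a continuous map $f:\mathbb{R}^n\to\mathbb{R}^n$ of the form $f(x)=(f_1(x_1),\ldots,f_n(x_n))^T$ such that for each $i$: $x_if_i(x_i)>0$ for all $x_i\ne 0$, and $|f_i(x_i)|\le|x_i|$ for all $x_i$. Write $x^{(k)}=(x^T(k),x^T(k-1),\ldots,x^T(k-l))^T\in\mathbb{R}^{(l+1)n}$. $V$ is a common Lyapunov--Krasovskii functional for the family if its difference $V(x^{(k+1)})-V(x^{(k)})$ along trajectories of every subsystem is negative, i.e. for every $s\in\{1,\ldots,N\}$ and every $x^{(k)}\ne 0$, where $x(k+1)$ is given by the $s$-th subsystem. *)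

(* Defs.v *)
From HB Require Import structures.
From mathcomp Require Import all_boot all_order all_algebra.
From mathcomp Require Import all_classical all_reals all_analysis.

Set Implicit Arguments.
Unset Strict Implicit.
Unset Printing Implicit Defensive.

Import Order.TTheory GRing.Theory Num.Theory.
Import numFieldNormedType.Exports.

Local Open Scope ring_scope.

Definition vec_le (R : realType) (n : nat) (v w : 'cV[R]_n) : Prop :=
  forall i, v i 0 <= w i 0.

Definition vec_pos (R : realType) (n : nat) (v : 'cV[R]_n) : Prop :=
  forall i, 0 < v i 0.

Definition nonneg_mx (R : realType) (m n : nat) (A : 'M[R]_(m, n)) : Prop :=
  forall i j, 0 <= A i j.

Definition admissible (R : realType) (n : nat) (f : 'cV[R]_n -> 'cV[R]_n) :
    Prop :=
  continuous f /\
  exists g : 'I_n -> R -> R,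
    [/\ forall x, f x = \col_i g i (x i 0),
        forall i t, t != 0 -> 0 < t * g i t
      & forall i t, `|g i t| <= `|t|].

Definition quad (R : realType) (n : nat) (P : 'M[R]_n) (u : 'cV[R]_n) : R :=
  (u^T *m P *m u) 0 0.

Definition posdef_mx (R : realType) (n : nat) (P : 'M[R]_n) : Prop :=
  P^T = P /\ forall u : 'cV[R]_n, u != 0 -> 0 < quad P u.

(* The column vector of length (l + 1) n made of l + 1 blocks of length n. *)
Notation "''cV[' R ]_( l ; n )" := 'cV[R]_(\sum_(j < l.+1) n)
  (at level 0, only parsing) : type_scope.

(* x^(k) = (x(k)^T, x(k-1)^T, ..., x(k-l)^T)^T; times are integers, so that the
   delayed arguments k - j are not truncated. *)
Definition history (R : realType) (n l : nat) (x : int -> 'cV[R]_n) (k : int) :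
    'cV[R]_(l; n) :=
  \mxcol_(j < l.+1) x (k - j%:Z).

(* Q j with j : 'I_l is the matrix Q_(j+1): it weighs the block of index j.+1,
   i.e. x(k-j-1). *)
Definition LK_form (R : realType) (n l : nat) (P : 'M[R]_n)
    (Q : 'I_l -> 'M[R]_n) (X : 'cV[R]_(l; n)) : R :=
  quad P (submxcol X ord0) + \sum_(j < l) quad (Q j) (submxcol X (lift ord0 j)).

(* Only the step from k to k+1 is required to obey the s-th subsystem, so
   x^(k) ranges over all nonzero vectors of R^((l+1)n). *)
Definition common_LK (R : realType) (n N l : nat) (f : 'cV[R]_n -> 'cV[R]_n)
    (A B : 'I_N -> 'M[R]_n) (V : 'cV[R]_(l; n) -> R) : Prop :=
  forall (s : 'I_N) (x : int -> 'cV[R]_n) (k : int),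
    x (k + 1) = f (A s *m x k + B s *m x (k - l%:Z)) ->
    history l x k != 0 ->
    V (history l x (k + 1)) - V (history l x k) < 0.

(* Main.v *)
Require Import Defs.
From mathcomp Require Import all_boot all_order all_algebra.
From mathcomp Require Import all_classical all_reals all_analysis.
From mathcomp Require Import ring lra.

Import Order.TTheory GRing.Theory Num.Theory.
Import numFieldNormedType.Exports.

Local Open Scope ring_scope.

(** Put [p_i = d_i / theta_i]. Since [|f_i(t)| <= |t|], the new state satisfies
    [x_i(k+1)^2 <= (A_s x(k) + B_s x(k-l))_i^2]. Cauchy-Schwarz with weights
    [theta] bounds this square by [((A_s + B_s) theta)_i <= lambda theta_i]
    times a nonnegative combination of the [x_j^2 / theta_j]; summing against
    [p_i] turns the matrices into their transposes applied to [d]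
    ([diag_form_contraction], [delay_form_contraction]):

      [sum_i p_i x_i(k+1)^2 <= sum_i (lambda (A_s^T d)_i x_i(k)^2
                                + lambda (B_s^T d)_i x_i(k-l)^2) / theta_i].

    It remains to distribute [d_i] among the blocks. Let
    [beta_i = max_r (B_r^T d)_i]. The mixed inequalities
    [(A_s + B_r)^T d <= mu d] give [A_s^T d + beta <= mu d] for every [s], so
    [lambda mu < 1] leaves in each coordinate a slack [(1 - lambda mu) d_i],
    which is cut into [l + 1] equal parts [e_i]. The weight of [x_i(k-m)^2],
    for [m] from [1] to [l], is [(lambda beta_i + (l - m + 1) e_i) / theta_i]:
    it loses [e_i / theta_i] each time the block grows older by one step.
    The difference of the functional then telescopes
    ([delay_line_telescope]) and is at most
    [- sum_i (e_i / theta_i) sum_(m <= l) x_i(k-m)^2], which is negative as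
    soon as some block of the history is nonzero. *)

(** * Diagonal quadratic forms *)

Lemma quad_diag (R : realType) (n : nat) (p : 'rV[R]_n) (u : 'cV[R]_n) :
  quad (diag_mx p) u = \sum_i p 0 i * u i 0 ^+ 2.
Proof.
rewrite /quad mul_mx_diag mxE; apply: eq_bigr => i _.
by rewrite !mxE mulrAC mulrC expr2.
Qed.

Lemma posdef_diag (R : realType) (n : nat) (p : 'rV[R]_n) :
  (forall i, 0 < p 0 i) -> posdef_mx (diag_mx p).
Proof.
move=> p_gt0; split=> [|u]; first exact: tr_diag_mx.
move=> /matrix0Pn [i [j]]; rewrite ord1 => ui_neq0.
have terms_ge0 (h : 'I_n) : 0 <= p 0 h * u h 0 ^+ 2.
  by rewrite mulr_ge0 ?sqr_ge0// ltW.
rewrite quad_diag (bigD1 i)//= ltr_pwDl ?sumr_ge0//.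
by rewrite mulr_gt0// exprn_even_gt0.
Qed.

(** * Contraction of a diagonal form by a nonnegative matrix *)

(** Expand [0 <= sum_t a_t th_t (u_t / th_t - c)^2] at [c = L / sigma], where
    [L = sum_t a_t u_t]. Bounding [sum_t a_t th_t] by a positive [sigma] rather
    than dividing by the sum itself covers the case where all [a_t] vanish. *)
Lemma weighted_cauchy_schwarz (R : realFieldType) (T : finType)
    (a th u : T -> R) (sigma : R) :
  (forall t, 0 <= a t) -> (forall t, 0 < th t) -> 0 < sigma ->
  \sum_t a t * th t <= sigma ->
  (\sum_t a t * u t) ^+ 2 <= sigma * \sum_t a t * (u t ^+ 2 / th t).
Proof.
move=> a_ge0 th_gt0 sigma_gt0 le_sigma.
set L := \sum_t a t * u t; set S := \sum_t _ in le_sigma; set Q := \sum_t _.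
pose c := L / sigma.
have expand : \sum_t a t * th t * (u t / th t - c) ^+ 2
              = Q - 2 * c * L + c ^+ 2 * S.
  rewrite /Q /L /S !mulr_sumr -sumrB -big_split/=; apply: eq_bigr => t _.
  by field; rewrite gt_eqF.
have : 0 <= Q - 2 * c * L + c ^+ 2 * S.
  rewrite -expand sumr_ge0// => t _; have := ltW (th_gt0 t) => th_ge0.
  by rewrite mulr_ge0 ?sqr_ge0// mulr_ge0.
have : c ^+ 2 * S <= c ^+ 2 * sigma by rewrite ler_wpM2l ?sqr_ge0.
have -> : c ^+ 2 * sigma = c * L by rewrite /c; field; rewrite gt_eqF.
move=> h1 h2; have h3 : c * L <= Q by lra.
have -> : L ^+ 2 = sigma * (c * L) by rewrite /c; field; rewrite gt_eqF.
by rewrite ler_pM2l.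
Qed.

(** Cauchy-Schwarz in each row, then summation over the rows with weights
    [d_i / w_i]: the factor [w_i] produced by [M th <= lam w] cancels and
    leaves the column sums [M^T d]. *)
Lemma diag_form_contraction (R : realType) (m p : nat) (M : matrix R m p)
    (d w : 'cV[R]_m) (th u : 'cV[R]_p) (lam : R) :
  nonneg_mx M -> vec_pos d -> vec_pos w -> vec_pos th -> 0 < lam ->
  vec_le (M *m th) (lam *: w) ->
  \sum_i d i 0 / w i 0 * (M *m u) i 0 ^+ 2
  <= lam * \sum_j (M^T *m d) j 0 * (u j 0 ^+ 2 / th j 0).
Proof.
move=> M_ge0 d_gt0 w_gt0 th_gt0 lam_gt0 le_Mth.
have row_le i : d i 0 / w i 0 * (M *m u) i 0 ^+ 2
    <= lam * \sum_j d i 0 * M i j * (u j 0 ^+ 2 / th j 0).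
  have sigma_gt0 : 0 < lam * w i 0 by rewrite mulr_gt0.
  have := le_Mth i; rewrite !mxE => le_sigma.
  have CS := weighted_cauchy_schwarz _ _ _ _ (fun j => u j 0) _ (M_ge0 i) th_gt0
    sigma_gt0 le_sigma.
  have dw_ge0 : 0 <= d i 0 / w i 0 by rewrite divr_ge0// ltW.
  apply: le_trans (ler_wpM2l dw_ge0 CS) _.
  under [X in _ <= _ * X]eq_bigr do rewrite -mulrA.
  rewrite -mulr_sumr; set S := \sum_j _.
  by rewrite le_eqVlt; apply/orP; left; apply/eqP; field; rewrite gt_eqF.
apply: le_trans (ler_sum _ (fun i _ => row_le i)) _.
rewrite -mulr_sumr exchange_big/= le_eqVlt; apply/orP; left; apply/eqP.
congr (_ * _); apply: eq_bigr => j _; rewrite -mulr_suml; congr (_ * _).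
by rewrite mxE; apply: eq_bigr => i _; rewrite mxE mulrC.
Qed.

(** The delayed system is the undelayed one with matrix [(A B)] acting on the
    stacked vector of [u] and [v], the weights [th] being stacked twice. *)
Lemma delay_form_contraction (R : realType) (n : nat) (A B : 'M[R]_n)
    (d th u v : 'cV[R]_n) (lam : R) :
  nonneg_mx A -> nonneg_mx B -> vec_pos d -> vec_pos th -> 0 < lam ->
  vec_le ((A + B) *m th) (lam *: th) ->
  \sum_i d i 0 / th i 0 * (A *m u + B *m v) i 0 ^+ 2
  <= \sum_i (lam * (A^T *m d) i 0 / th i 0 * u i 0 ^+ 2
             + lam * (B^T *m d) i 0 / th i 0 * v i 0 ^+ 2).
Proof.
move=> A_ge0 B_ge0 d_gt0 th_gt0 lam_gt0 le_th.
have M_ge0 : nonneg_mx (row_mx A B).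
  by move=> i j; rewrite mxE; case: fintype.split => h.
have thth_gt0 : vec_pos (col_mx th th).
  by move=> i; rewrite mxE; case: fintype.split => h.
have le_M : vec_le (row_mx A B *m col_mx th th) (lam *: th).
  by rewrite mul_row_col -mulmxDl.
have := diag_form_contraction _ _ _ _ _ _ _ (col_mx u v) _
  M_ge0 d_gt0 th_gt0 thth_gt0 lam_gt0 le_M.
rewrite mul_row_col tr_row_mx mul_col_mx big_split_ord/= => /le_trans; apply.
rewrite -big_split/= mulr_sumr le_eqVlt; apply/orP; left; apply/eqP.
by apply: eq_bigr => i _; rewrite !col_mxEu !col_mxEd; ring.
Qed.

(** * The functional along trajectories *)

(** Shifting the history by one step moves [y_m] from the weight [c_m] to
    [c_(m-1)]; when the weights decrease by [e], everything but the two ends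
    cancels, up to a loss [e y_m] at each step. *)
Lemma delay_line_telescope (R : comPzRingType) (l : nat) (c y : nat -> R)
    (e : R) :
  (forall j, (j < l)%N -> c j = c j.+1 + e) ->
  \sum_(j < l) c j * y j - \sum_(j < l) c j * y j.+1
  = c 0%N * y 0%N - c l * y l - e * \sum_(j < l) y j.+1.
Proof.
elim: l => [|l IHl] c_step; first by rewrite !big_ord0; ring.
rewrite !big_ord_recr/=.
rewrite opprD addrACA IHl => [|j lt_jl]; last by rewrite c_step// ltnW.
by rewrite (c_step l)//; ring.
Qed.

Lemma LK_form_history (R : realType) (n l : nat) (p : 'rV[R]_n)
    (q : 'I_l -> 'rV[R]_n) (x : int -> 'cV[R]_n) (k : int) :
  LK_form (diag_mx p) (fun j => diag_mx (q j)) (history l x k)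
  = \sum_i (p 0 i * x k i 0 ^+ 2
            + \sum_(j < l) q j 0 i * x (k - j.+1%:Z) i 0 ^+ 2).
Proof.
rewrite /LK_form /history mxcolK quad_diag subr0 big_split/=; congr (_ + _).
rewrite exchange_big/=; apply: eq_bigr => j _.
by rewrite mxcolK quad_diag.
Qed.

Lemma history_neq0 (R : realType) (n l : nat) (x : int -> 'cV[R]_n) (k : int) :
  history l x k != 0 -> exists (i : 'I_n) (j : 'I_l.+1), x (k - j%:Z) i 0 != 0.
Proof.
move=> /matrix0Pn [i [j]]; rewrite ord1 => hij.
by exists (tagnat.sig2 i), (tagnat.sig1 i); move: hij; rewrite !mxE.
Qed.

Lemma admissible_sqr_le (R : realType) (n : nat) (f : 'cV[R]_n -> 'cV[R]_n)
    (z : 'cV[R]_n) (i : 'I_n) :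
  admissible f -> f z i 0 ^+ 2 <= z i 0 ^+ 2.
Proof.
move=> [_ [g [fE _ g_le]]]; rewrite fE mxE.
by rewrite -(real_normK (num_real (g _ _))) -(real_normK (num_real (z i 0)))
  lerXn2r ?nnegrE.
Qed.

(** It suffices to bound the quadratic form of the new state by terms in
    [x(k)] and [x(k-l)] whose coefficients [a] and [b] fit into the weights
    with a uniform margin [e]: the weights at the two ends absorb [a] and [b],
    and the decrements absorb the rest. *)
Lemma LK_form_decrease (R : realType) (n l : nat) (p a b e : 'I_n -> R)
    (c : nat -> 'I_n -> R) (x : int -> 'cV[R]_n) (k : int)
    (V := LK_form (diag_mx (\row_i p i))
            (fun j : 'I_l => diag_mx (\row_i c j i))) :
  (forall i, 0 < e i) ->
  (forall j i, (j < l)%N -> c j i = c j.+1 i + e i) ->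
  (forall i, a i + c 0%N i + e i <= p i) -> (forall i, b i <= c l i) ->
  \sum_i p i * x (k + 1) i 0 ^+ 2
  <= \sum_i (a i * x k i 0 ^+ 2 + b i * x (k - l%:Z) i 0 ^+ 2) ->
  history l x k != 0 ->
  V (history l x (k + 1)) - V (history l x k) < 0.
Proof.
move=> e_gt0 c_step le_p le_b le_new /history_neq0 [i0 [j0 x_neq0]].
pose y i j := x (k - j%:Z) i 0 ^+ 2.
have y_ge0 i j : 0 <= y i j by exact: sqr_ge0.
have yk i : x k i 0 ^+ 2 = y i 0%N by rewrite /y subr0.
have drop_gt0 : 0 < \sum_i e i * \sum_(j < l.+1) y i j.
  have term_ge0 i : 0 <= e i * \sum_(j < l.+1) y i j.
    by rewrite mulr_ge0 ?sumr_ge0// ltW.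
  rewrite (bigD1 i0)//= ltr_pwDl ?sumr_ge0//.
  rewrite mulr_gt0// (bigD1 j0)//= ltr_pwDl ?sumr_ge0//.
  by rewrite exprn_even_gt0.
have le_coord i :
    (\sum_(j < l) c j i * y i j)
      - (p i * y i 0%N + \sum_(j < l) c j i * y i j.+1)
    <= - (a i * y i 0%N + b i * y i l) - e i * \sum_(j < l.+1) y i j.
  have tele := delay_line_telescope _ l (fun j => c j i) (y i) (e i)
    (fun j => c_step j i).
  have h0 : 0 <= (p i - (a i + c 0%N i + e i)) * y i 0%N.
    by rewrite mulr_ge0// subr_ge0.
  have hl : 0 <= (c l i - b i) * y i l by rewrite mulr_ge0// subr_ge0.
  rewrite big_ord_recl/=; rewrite /= in tele.
  under [X in - (_ * (_ + X))]eq_bigr do rewrite /bump/= add1n.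
  lra.
rewrite /V !LK_form_history.
have -> : \sum_i ((\row_i p i) 0 i * x (k + 1) i 0 ^+ 2
      + \sum_(j < l) (\row_i c j i) 0 i * x (k + 1 - j.+1%:Z) i 0 ^+ 2)
    = \sum_i p i * x (k + 1) i 0 ^+ 2 + \sum_i \sum_(j < l) c j i * y i j.
  rewrite -big_split; apply: eq_bigr => i _ /=; rewrite mxE; congr (_ + _).
  apply: eq_bigr => j _; rewrite mxE /y.
  by rewrite -[j.+1]addn1 PoszD opprD addrACA subrr addr0.
have -> : \sum_i ((\row_i p i) 0 i * x k i 0 ^+ 2
      + \sum_(j < l) (\row_i c j i) 0 i * x (k - j.+1%:Z) i 0 ^+ 2)
    = \sum_i (p i * y i 0%N + \sum_(j < l) c j i * y i j.+1).
  apply: eq_bigr => i _; rewrite mxE yk; congr (_ + _).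
  by apply: eq_bigr => j _; rewrite mxE.
have := ler_sum (index_enum _) (fun i (_ : xpredT i) => le_coord i).
rewrite /= !sumrB sumrN; move: le_new; under [leRHS]eq_bigr do rewrite yk.
by move: drop_gt0; rewrite /y /=; lra.
Qed.

Theorem theorem6p1 (R : realType) (n N l : nat)
    (hn : (0 < n)%N) (hN : (0 < N)%N) (hl : (0 < l)%N)
    (A B : 'I_N -> 'M[R]_n)
    (hA : forall s, nonneg_mx (A s)) (hB : forall s, nonneg_mx (B s))
    (f : 'cV[R]_n -> 'cV[R]_n) (hf : admissible f) :
  (exists (mu lambda : R) (d theta : 'cV[R]_n),
    0 < mu /\ 0 < lambda /\ vec_pos d /\ vec_pos theta /\
    (forall s r, vec_le ((A s + B r)^T *m d) (mu *: d)) /\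
    (forall s, vec_le ((A s + B s) *m theta) (lambda *: theta)) /\
    lambda * mu < 1) ->
  exists (P : 'M[R]_n) (Q : 'I_l -> 'M[R]_n),
    is_diag_mx P /\ posdef_mx P /\
    (forall j, is_diag_mx (Q j) /\ posdef_mx (Q j)) /\
    common_LK f A B (LK_form P Q).
Proof.
move=> [mu [lam [d [th [_ [lam_gt0 [d_gt0 [th_gt0 [le_d [le_th lt1]]]]]]]]]].
pose beta i := \big[Num.max/0]_r ((B r)^T *m d) i 0.
have beta_ge0 i : 0 <= beta i by exact: bigmax_ge_id.
have le_beta s i : ((B s)^T *m d) i 0 <= beta i.
  exact: (le_bigmax _ (fun r => ((B r)^T *m d) i 0)).
have BTd_ge0 s i : 0 <= ((B s)^T *m d) i 0.
  by rewrite mxE sumr_ge0// => j _; rewrite mxE mulr_ge0 ?hB// ltW.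
have mixed_le s r i : ((A s)^T *m d) i 0 + ((B r)^T *m d) i 0 <= mu * d i 0.
  by have := le_d s r i; rewrite linearD/= mulmxDl !mxE.
have alpha_beta_le s i : ((A s)^T *m d) i 0 + beta i <= mu * d i 0.
  rewrite -lerBrDl; apply/bigmax_leP; split=> [|r _].
    by rewrite subr_ge0 (le_trans _ (mixed_le s s i))// lerDl.
  by rewrite lerBrDl.
pose e i := (1 - lam * mu) * d i 0 / l.+1%:R.
have e_gt0 i : 0 < e i by rewrite !mulr_gt0 ?invr_gt0 ?subr_gt0.
have eE i : l.+1%:R * e i = (1 - lam * mu) * d i 0.
  by rewrite /e mulrC divfK// pnatr_eq0.
(* [c j] is the weight of the block [x(k-j-1)]; the value [c l], the part
   [lam * beta] left after the [l] decrements, is the loss charged to the last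
   block when it leaves the history. *)
pose c (j : nat) i := (lam * beta i + (l - j)%:R * e i) / th i 0.
exists (diag_mx (\row_i (d i 0 / th i 0))),
  (fun j : 'I_l => diag_mx (\row_i c j i)).
split; first exact: diag_mx_is_diag.
split; first by apply: posdef_diag => i; rewrite mxE divr_gt0.
split=> [j|s x k x_next].
  split; first exact: diag_mx_is_diag.
  apply: posdef_diag => i; rewrite mxE divr_gt0// ltr_wpDl//.
    by rewrite mulr_ge0// ltW.
  by rewrite mulr_gt0// ltr0n subn_gt0.
apply: (LK_form_decrease _ _ _ _ (fun i => lam * ((A s)^T *m d) i 0 / th i 0)
  (fun i => lam * ((B s)^T *m d) i 0 / th i 0) (fun i => e i / th i 0)).
- by move=> i; rewrite divr_gt0.
- move=> j i lt_jl; rewrite /c -mulrDl subnS.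
  by rewrite -{1}(prednK (_ : (0 < l - j)%N)) ?subn_gt0// -natr1; ring.
- move=> i; rewrite /c subn0 -!mulrDl ler_pM2r ?invr_gt0//.
  have := ler_wpM2l (ltW lam_gt0) (alpha_beta_le s i).
  by have := eE i; rewrite -natr1; lra.
- move=> i; rewrite /c subnn mul0r addr0 ler_pM2r ?invr_gt0//.
  by rewrite ler_pM2l.
apply: le_trans (delay_form_contraction _ _ _ _ _ _ (x k) (x (k - l%:Z)) _
  (hA s) (hB s) d_gt0 th_gt0 lam_gt0 (le_th s)).
apply: ler_sum => i _; rewrite x_next.
by apply: ler_wpM2l; [rewrite divr_ge0// ltW | exact: admissible_sqr_le].
Qed.
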